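(* Let $\Omega\subset\mathbb{R}^2$ be open, $\lambda>0$, and let $u\in L^2(\Omega)$ satisfy $-\Delta u=\lambda u$ in $\Omega$. Let $\mathbf{x}_0\in\Omega$, $h>0$, and let $\mathbf{e}^-,\mathbf{e}^+$ be unit vectors with angle $\alpha\pi$ from $\mathbf{e}^-$ to $\mathbf{e}^+$, where $\alpha\in(0,2)$ is irrational; put $\Gamma^\pm=\{\mathbf{x}_0+t\mathbf{e}^\pm:0\le t\le h\}\subset\Omega$. Suppose $\Gamma^-$ is a singular line of $u$ ($\partial_\nu u=0$ on $\Gamma^-$, $\nu$ a unit normal to $\Gamma^-$) and $\Gamma^+$ is a nodal line of $u$ ($u=0$ on $\Gamma^+$). Then $\mathrm{Vani}(u;\mathbf{x}_0)=+\infty$.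
   Context: No boundary condition is imposed on $\partial\Omega$; $u$ is real-analytic in $\Omega$. $\mathrm{Vani}(u;\mathbf{x}_0)$ is the smallest degree of a nonzero homogeneous term in the Taylor expansion of $u$ at $\mathbf{x}_0$ ($+\infty$ if all vanish). *)

(* Defs.v *)
From HB Require Import structures.
From mathcomp Require Import all_boot all_order all_algebra.
From mathcomp Require Import all_classical all_reals all_analysis.
Set Implicit Arguments. Unset Strict Implicit. Unset Printing Implicit Defensive.
Import Order.TTheory GRing.Theory Num.Theory.
Import numFieldNormedType.Exports.
Local Open Scope classical_set_scope.
Local Open Scope ring_scope.

Section Defs.
Variable R : realType.

Definition pt := (R * R)%type.

Definition padd (p q : pt) : pt := (p.1 + q.1, p.2 + q.2).
Definition pscale (t : R) (p : pt) : pt := (t * p.1, t * p.2).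

Definition ex : pt := (1, 0).
Definition ey : pt := (0, 1).

Definition dx (f : pt -> R) : pt -> R := fun p => derive f p ex.
Definition dy (f : pt -> R) : pt -> R := fun p => derive f p ey.

Definition pderiv (i j : nat) (f : pt -> R) : pt -> R := iter i dx (iter j dy f).

Definition laplacian (f : pt -> R) : pt -> R := fun p => dx (dx f) p + dy (dy f) p.

Definition dirderiv (f : pt -> R) (v : pt) (p : pt) : R := derive f p v.

(* real-analyticity on Omega: near every point, f is the sum of an absolutely
   convergent double power series (square partial sums). *)
Definition real_analytic_on (Omega : set pt) (f : pt -> R) : Prop :=
  forall p, Omega p -> exists r : R, 0 < r /\ exists a : nat -> nat -> R,
    forall h : pt, `|h.1| < r -> `|h.2| < r ->
      (exists M : R, forall N : nat,
          \sum_(i < N) \sum_(j < N) `|a i j| * `|h.1| ^+ i * `|h.2| ^+ j <= M) /\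
      ((fun N : nat => \sum_(i < N) \sum_(j < N) a i j * h.1 ^+ i * h.2 ^+ j)
         @ \oo --> f (padd p h)).

Definition leb2 := ((@lebesgue_measure R) \x (@lebesgue_measure R))%E.

Definition in_L2 (Omega : set pt) (f : pt -> R) : Prop :=
  measurable_fun Omega f /\
  (\int[leb2]_(x in Omega) ((f x) ^+ 2)%:E < +oo)%E.

(* Vani(f; x0) = +oo : every homogeneous Taylor term at x0 vanishes, i.e.
   all Taylor coefficients d_x^i d_y^j f(x0) / (i! j!) are zero. *)
Definition vani_infinite (f : pt -> R) (x0 : pt) : Prop :=
  forall i j : nat, pderiv i j f x0 = 0.

Definition rot2 (theta : R) (e : pt) : pt :=
  (cos theta * e.1 - sin theta * e.2, sin theta * e.1 + cos theta * e.2).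

Definition unit_vec (e : pt) : Prop := e.1 ^+ 2 + e.2 ^+ 2 = 1.

Definition segment (x0 e : pt) (h : R) : set pt :=
  [set q | exists t : R, 0 <= t <= h /\ q = padd x0 (pscale t e)].

End Defs.

(* Main.v *)
Require Import Defs.
From HB Require Import structures.
From mathcomp Require Import all_boot all_order all_algebra.
From mathcomp Require Import all_classical all_reals all_analysis.
From mathcomp Require Import ring lra zify.
Import Order.TTheory GRing.Theory Num.Theory.
Import numFieldNormedType.Exports.
Local Open Scope classical_set_scope.
Local Open Scope ring_scope.

(** Let [P] be the lowest-degree nonzero homogeneous part of the Taylor series
    of [u] at [x0], of degree [m].  The lowest-degree part of
    [Delta u + lambda u = 0] says that [P] is harmonic, so in polar coordinates
    [P = rho ^+ m * (A * cos (m * t) + B * sin (m * t))].  The lowest-degree parts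
    of the two conditions on the segments say that the normal derivative of [P]
    vanishes in direction [em] and that [P] vanishes in direction [ep]; this is a
    linear system for [(A, B)] of determinant [cos (m * alpha * pi)] up to sign.
    It is nonzero because [alpha] is irrational (and [m > 0] since [u x0 = 0]),
    so [P = 0], a contradiction. *)

(** * Double series: square and near-square partial sums *)

Section SquareSums.
Context {R : realType}.
Implicit Types F : nat -> nat -> R.

(* The rectangular sums occur because differentiating the square partial sums termwise drops one row or column. *)
Lemma square_sum_nonneg_cvg F (M : R) :
  (forall i j, 0 <= F i j) ->
  (forall N, \sum_(i < N) \sum_(j < N) F i j <= M) ->
  exists l : R,
    [/\ (fun N : nat => \sum_(i < N) \sum_(j < N) F i j) @ \oo --> l,
        (fun N : nat => \sum_(i < N.+1) \sum_(j < N) F i j) @ \oo --> l &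
        (fun N : nat => \sum_(i < N) \sum_(j < N.+1) F i j) @ \oo --> l].
Proof.
move=> F0 FM; set S := fun N : nat => \sum_(i < N) \sum_(j < N) F i j.
set X := fun N : nat => \sum_(i < N.+1) \sum_(j < N) F i j.
set Y := fun N : nat => \sum_(i < N) \sum_(j < N.+1) F i j.
(* Each rectangular sum lies between two consecutive square sums, so the squeeze theorem gives all
   three the same limit. *)
have SX n : S n <= X n.
  by rewrite /X big_ord_recr lerDl sumr_ge0.
have XS n : X n <= S n.+1.
  by apply: ler_sum => i _; rewrite big_ord_recr lerDl.
have SY n : S n <= Y n.
  by apply: ler_sum => i _; rewrite big_ord_recr lerDl.
have YS n : Y n <= S n.+1.
  by rewrite /S big_ord_recr lerDl sumr_ge0.
have Scvg : cvgn S.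
  apply: nondecreasing_is_cvgn.
    by apply/nondecreasing_seqP => n; exact: le_trans (SX n) (XS n).
  by exists M => _ [n _ <-]; exact: FM.
have S1 : (fun n => S n.+1) @ \oo --> limn S by rewrite -cvg_shiftS in Scvg *.
exists (limn S); split => //.
- by apply: (squeeze_cvgr _ Scvg S1); near=> n; rewrite SX XS.
- by apply: (squeeze_cvgr _ Scvg S1); near=> n; rewrite SY YS.
Unshelve. all: by end_near. Qed.

(** Writing [F = (|F| + F) - |F|] reduces to the nonnegative case, since [|F| + F] lies between 0
    and [2 |F|]. *)
Lemma square_sum_cvg F (M : R) :
  (forall N, \sum_(i < N) \sum_(j < N) `|F i j| <= M) ->
  exists l : R,
    [/\ (fun N : nat => \sum_(i < N) \sum_(j < N) F i j) @ \oo --> l,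
        (fun N : nat => \sum_(i < N.+1) \sum_(j < N) F i j) @ \oo --> l &
        (fun N : nat => \sum_(i < N) \sum_(j < N.+1) F i j) @ \oo --> l].
Proof.
move=> FM.
have [l1 [A1 B1 C1]] := @square_sum_nonneg_cvg (fun i j => `|F i j|) M
  (fun _ _ => normr_ge0 _) FM.
have [|N|l2 [A2 B2 C2]] :=
    @square_sum_nonneg_cvg (fun i j => `|F i j| + F i j) (M + M).
- by move=> i j; have := ler_norm (- F i j); rewrite normrN; lra.
- apply: le_trans (lerD (FM N) (FM N)); rewrite -big_split/=.
  apply: ler_sum => i _; rewrite -big_split/=.
  by apply: ler_sum => j _; rewrite lerD2l ler_norm.
have E m n : \sum_(i < m) \sum_(j < n) F i j =
    (\sum_(i < m) \sum_(j < n) (`|F i j| + F i j)) -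
    \sum_(i < m) \sum_(j < n) `|F i j|.
  rewrite -sumrB; apply: eq_bigr => i _; rewrite -sumrB.
  by apply: eq_bigr => j _; rewrite addrAC subrr add0r.
exists (l2 - l1); split; under eq_fun do rewrite E; exact: cvgB.
Qed.

End SquareSums.

(** * Second-order Taylor remainders of powers and monomials *)

(** The remainder is [t ^+ 2] times a polynomial in [x] and [t] with nonnegative coefficients, so
    replacing [x] by [|x|] and [t] by [s] gains the factor [(e / s) ^+ 2]. A bound by a power of
    [|x| + s] can be summed against a power series. *)
Lemma power_remainder_le {R : realType} (x s t e : R) (n : nat) :
  0 < s -> `|t| <= e -> e <= s ->
  `|(x + t) ^+ n - x ^+ n - t * (n%:R * x ^+ n.-1)|
    <= (e / s) ^+ 2 * (`|x| + s) ^+ n.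
Proof.
move=> s0 te es.
have e0 : 0 <= e by exact: le_trans te.
(* The induction needs the sharper bound by the remainder at [(|x|, s)], which obeys the same
   recursion [step]. *)
suff: `|(x + t) ^+ n - x ^+ n - t * (n%:R * x ^+ n.-1)|
    <= (e / s) ^+ 2 * ((`|x| + s) ^+ n - `|x| ^+ n - s * (n%:R * `|x| ^+ n.-1)).
  move/le_trans; apply; rewrite ler_wpM2l ?sqr_ge0//.
  rewrite -addrA -opprD gerBl addr_ge0 ?exprn_ge0//.
  by rewrite mulr_ge0 ?(ltW s0)// mulr_ge0 ?exprn_ge0.
elim: n => [|n IH]; first by rewrite !expr0 !mul0r !mulr0 !subrr normr0 mulr0.
have step (X T : R) : (X + T) ^+ n.+1 - X ^+ n.+1 - T * (n.+1%:R * X ^+ n.+1.-1)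
   = (X + T) * ((X + T) ^+ n - X ^+ n - T * (n%:R * X ^+ n.-1))
     + T ^+ 2 * (n%:R * X ^+ n.-1).
  case: n {IH} => [|n]/=; first by rewrite !expr0 !expr1; ring.
  rewrite !exprS -!natr1; ring.
rewrite !step [leRHS]mulrDr (le_trans (ler_normD _ _))// lerD//.
  rewrite normrM [leRHS]mulrCA ler_pM//.
  by rewrite (le_trans (ler_normD _ _))// lerD2l (le_trans te).
rewrite [leRHS]mulrA -exprMn divfK ?gt_eqF// normrM normrX normrM normrX normr_nat.
apply: ler_wpM2r; first by rewrite mulr_ge0 ?exprn_ge0.
by rewrite lerXn2r ?nnegrE.
Qed.

(** The left-hand side is one term of the binomial expansion of the right-hand side. *)
Lemma power_derivative_le {R : realType} (x s : R) (n : nat) : 0 < s ->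
  s * (n%:R * `|x| ^+ n.-1) <= (`|x| + s) ^+ n.
Proof.
move=> s0; elim: n => [|n IH]; first by rewrite mul0r mulr0 expr0.
case: n IH => [_|n IH]/=; first by rewrite expr0 expr1 !mul1r mulr1 lerDr.
rewrite [leRHS]exprS [leRHS]mulrDl.
have h1 : `|x| * (s * (n.+1%:R * `|x| ^+ n)) <= `|x| * (`|x| + s) ^+ n.+1.
  by rewrite ler_wpM2l.
have h2 : s * `|x| ^+ n.+1 <= s * (`|x| + s) ^+ n.+1.
  by rewrite ler_wpM2l ?(ltW s0)// lerXn2r ?nnegrE ?addr_ge0 ?(ltW s0)// lerDl ltW.
apply: le_trans (lerD h1 h2).
rewrite le_eqVlt; apply/orP; left; apply/eqP.
by rewrite exprS -[n.+2%:R]natr1; ring.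
Qed.

Lemma monomial_remainder_le {R : realType} (x y s t1 t2 e : R) (i j : nat) :
  0 < s -> `|t1| <= e -> `|t2| <= e -> e <= s ->
  `|(x + t1) ^+ i * (y + t2) ^+ j - x ^+ i * y ^+ j
    - (t1 * (i%:R * x ^+ i.-1 * y ^+ j) + t2 * (x ^+ i * (j%:R * y ^+ j.-1)))|
    <= 4 * (e / s) ^+ 2 * ((`|x| + s) ^+ i * (`|y| + s) ^+ j).
Proof.
move=> s0 t1e t2e es; have e0 : 0 <= e by exact: le_trans t1e.
have w0 : 0 <= e / s by rewrite divr_ge0 // ltW.
have w1 : e / s <= 1 by rewrite ler_pdivrMr// mul1r.
have A := power_remainder_le x s t1 e i s0 t1e es.
have B := power_remainder_le y s t2 e j s0 t2e es.
have pow_le (z t : R) n : `|t| <= s -> `|(z + t) ^+ n| <= (`|z| + s) ^+ n.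
  move=> ts; rewrite normrX lerXn2r ?nnegrE ?addr_ge0// ?(ltW s0)//.
  by rewrite (le_trans (ler_normD _ _))// lerD2l.
have der_le (z t : R) n : `|t| <= e ->
    `|t * (n%:R * z ^+ n.-1)| <= e / s * (`|z| + s) ^+ n.
  move=> te; rewrite normrM (normrM n%:R) normrX normr_nat -mulrA.
  by rewrite ler_pM// ler_pdivlMl// power_derivative_le.
have Y1 := pow_le y t2 j (le_trans t2e es).
have X0 : `|x ^+ i| <= (`|x| + s) ^+ i.
  by have := pow_le x 0 i; rewrite addr0 normr0; apply; exact: ltW.
have X1 := der_le x t1 i t1e; have Y2 := der_le y t2 j t2e.
have Y3 : `|(y + t2) ^+ j - y ^+ j| <= 2 * (e / s) * (`|y| + s) ^+ j.
  rewrite -[X in `|X|](subrK (t2 * (j%:R * y ^+ j.-1))).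
  have -> : 2 * (e / s) * (`|y| + s) ^+ j
    = e / s * (`|y| + s) ^+ j + e / s * (`|y| + s) ^+ j by ring.
  rewrite (le_trans (ler_normD _ _))// lerD//.
  rewrite (le_trans B)// ler_wpM2r ?exprn_ge0 ?addr_ge0 ?(ltW s0)//.
  by rewrite expr2 ler_piMl.
set P := (x + t1) ^+ i in A *; set Q := (y + t2) ^+ j in B Y1 Y3 *.
set P1 := i%:R * x ^+ i.-1 in A X1 *; set Q1 := j%:R * y ^+ j.-1 in B Y2 *.
set X := (`|x| + s) ^+ i in A X0 X1 *; set Y := (`|y| + s) ^+ j in B Y1 Y2 Y3 *.
(* Product rule with remainders: the three terms contribute 1, 1 and 2 to the constant 4. *)
have -> : P * Q - x ^+ i * y ^+ j - (t1 * (P1 * y ^+ j) + t2 * (x ^+ i * Q1))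
  = (P - x ^+ i - t1 * P1) * Q + x ^+ i * (Q - y ^+ j - t2 * Q1)
    + (t1 * P1) * (Q - y ^+ j) by ring.
have -> : 4 * (e / s) ^+ 2 * (X * Y) = (e / s) ^+ 2 * X * Y
    + X * ((e / s) ^+ 2 * Y) + (e / s * X) * (2 * (e / s) * Y) by ring.
rewrite (le_trans (ler_normD _ _))// lerD//; last by rewrite normrM ler_pM.
by rewrite (le_trans (ler_normD _ _))// lerD// normrM ler_pM.
Qed.

Lemma derive_quadratic_remainder {R : realType} (f : pt R -> R) (q v : pt R)
    (l C d : R) : 0 < d ->
  (forall t, `|t| <= d -> `|f (padd q (pscale t v)) - f q - t * l| <= C * t ^+ 2) ->
  derive f q v = l.
Proof.
move=> d0 fl; apply: cvg_lim => //; apply/cvgrPdist_le => e e0.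
have C0 : 0 <= C.
  have := fl d; rewrite gtr0_norm// lexx => /(_ isT).
  by move=> /(le_trans (normr_ge0 _)); rewrite pmulr_lge0 ?exprn_gt0.
(* This radius keeps the error [C * |t|] of the difference quotient below [e]; the added 1 covers
   [C = 0]. *)
have k0 : 0 < Num.min d (e / (C + 1)).
  by rewrite lt_min d0 divr_gt0// ltr_wpDl.
near=> t.
have t0 : t != 0 by near: t; exact: nbhs_dnbhs_neq.
have : `|t| <= Num.min d (e / (C + 1)) by near: t; exact: dnbhs0_le.
rewrite le_min => /andP[td te].
rewrite /=.
rewrite [X in f X - _](_ : _ = padd q (pscale t v)); last by rewrite addrC.
rewrite distrC -[X in _ - X](mulKf t0) /GRing.scale/= -mulrBr normrM.
rewrite normfV ler_pdivrMl ?normr_gt0// (le_trans (fl t td))//.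
rewrite -real_normK ?num_real// expr2 mulrCA ler_wpM2l//.
move: te; rewrite ler_pdivlMr ?ltr_wpDl// => te; nra.
Unshelve. all: by end_near. Qed.

(** * Power series expansions: termwise differentiation and leading parts *)

Section AnalyticAt.
Context {R : realType}.
Implicit Types (f g : pt R -> R) (p v : pt R) (a b : nat -> nat -> R).

(** The inner condition of [real_analytic_on], with radius and coefficients as parameters, so that
    sums and derivatives keep the radius and have explicit coefficients. *)
Definition analytic_at f p (r : R) a : Prop :=
  forall h : pt R, `|h.1| < r -> `|h.2| < r ->
    (exists M : R, forall N : nat,
        \sum_(i < N) \sum_(j < N) `|a i j| * `|h.1| ^+ i * `|h.2| ^+ j <= M) /\
    ((fun N : nat => \sum_(i < N) \sum_(j < N) a i j * h.1 ^+ i * h.2 ^+ j)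
       @ \oo --> f (padd p h)).

Lemma analytic_at_add_scale f g p r a b (k : R) :
  analytic_at f p r a -> analytic_at g p r b ->
  analytic_at (fun q => f q + k * g q) p r (fun i j => a i j + k * b i j).
Proof.
move=> fa gb h h1 h2; have [[M HM] cf] := fa h h1 h2.
have [[M' HM'] cg] := gb h h1 h2; split.
  exists (M + `|k| * M') => N.
  apply: le_trans (lerD (HM N) (ler_wpM2l (normr_ge0 k) (HM' N))).
  rewrite mulr_sumr -big_split/=; apply: ler_sum => i _.
  rewrite mulr_sumr -big_split/=; apply: ler_sum => j _.
  rewrite !mulrA -normrM -!mulrDl ler_wpM2r ?exprn_ge0// ler_wpM2r ?exprn_ge0//.
  exact: ler_normD.
rewrite [X in X @ _](_ : _ = (fun N : nat =>
    (\sum_(i < N) \sum_(j < N) a i j * h.1 ^+ i * h.2 ^+ j) +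
    k * (\sum_(i < N) \sum_(j < N) b i j * h.1 ^+ i * h.2 ^+ j))).
  by apply: cvgD => //; apply: cvgM => //; exact: cvg_cst.
apply/funext => N; rewrite mulr_sumr -big_split/=; apply: eq_bigr => i _.
by rewrite mulr_sumr -big_split/=; apply: eq_bigr => j _; ring.
Qed.

(** The series still converges absolutely at [(|x| + s, |y| + s)]. This dominates the differentiated
    series and, through [monomial_remainder_le], bounds the error of the linear approximation by a
    multiple of [t ^+ 2]. *)
Lemma analytic_at_dirderiv f p r a v : analytic_at f p r a ->
  analytic_at (dirderiv f v) p r
    (fun i j => v.1 * (i.+1%:R * a i.+1 j) + v.2 * (j.+1%:R * a i j.+1)).
Proof.
move=> fa h; case: h => x y /= xr yr.
(* Half the max-norm distance from [(x, y)] to the boundary of the square. *)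
pose s := (r - Num.max `|x| `|y|) / 2.
have s0 : 0 < s by rewrite divr_gt0// subr_gt0 gt_max xr.
have [Xr Yr] : `|x| + s < r /\ `|y| + s < r.
  have : `|x| <= Num.max `|x| `|y| by rewrite le_max lexx.
  have : `|y| <= Num.max `|x| `|y| by rewrite le_max lexx orbT.
  by rewrite /s in s0 *; move: (Num.max _ _) s0 => m; lra.
have X0 : 0 <= `|x| + s by rewrite addr_ge0// ltW.
have Y0 : 0 <= `|y| + s by rewrite addr_ge0// ltW.
have [] := fa (`|x| + s, `|y| + s); rewrite /= ?(ger0_norm X0) ?(ger0_norm Y0)//; move=> [M HM] _.
pose H1 i j := a i j * (i%:R * x ^+ i.-1 * y ^+ j).
pose H2 i j := a i j * (x ^+ i * (j%:R * y ^+ j.-1)).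
have pow_le (z : R) n : `|z ^+ n| <= (`|z| + s) ^+ n.
  by rewrite normrX lerXn2r ?nnegrE ?addr_ge0 ?(ltW s0)// lerDl ltW.
have der_le (z : R) n : `|n%:R * z ^+ n.-1| <= s^-1 * (`|z| + s) ^+ n.
  by rewrite ler_pdivlMl// normrM normr_nat normrX power_derivative_le.
have H1M N : \sum_(i < N) \sum_(j < N) `|H1 i j| <= s^-1 * M.
  apply: le_trans (ler_wpM2l _ (HM N)); last by rewrite invr_ge0 ltW.
  rewrite mulr_sumr; apply: ler_sum => i _; rewrite mulr_sumr; apply: ler_sum => j _.
  rewrite normrM -[X in s^-1 * X]mulrA [leRHS]mulrCA ler_wpM2l// normrM [leRHS]mulrA.
  by rewrite ler_pM.
have H2M N : \sum_(i < N) \sum_(j < N) `|H2 i j| <= s^-1 * M.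
  apply: le_trans (ler_wpM2l _ (HM N)); last by rewrite invr_ge0 ltW.
  rewrite mulr_sumr; apply: ler_sum => i _; rewrite mulr_sumr; apply: ler_sum => j _.
  rewrite normrM -[X in s^-1 * X]mulrA [leRHS]mulrCA ler_wpM2l// normrM [leRHS]mulrCA.
  by rewrite ler_pM.
have [l1 [S1 D1 _]] := square_sum_cvg H1 _ H1M.
have [l2 [S2 _ D2]] := square_sum_cvg H2 _ H2M.
(* The row [i = 0] of [H1] is zero, so reindexing turns a rectangular sum into a square one. [G] is
   the norm for the absolute bound and the identity for the limit. *)
have H1_shift (G : R -> R) N : G 0 = 0 ->
    \sum_(i < N.+1) \sum_(j < N) G (H1 i j) = \sum_(i < N) \sum_(j < N) G (H1 i.+1 j).
  move=> G0; rewrite big_ord_recl/= [X in X + _]big1 ?add0r// => j _.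
  by rewrite /H1 !mul0r mulr0.
have H2_shift (G : R -> R) N : G 0 = 0 ->
    \sum_(i < N) \sum_(j < N.+1) G (H2 i j) = \sum_(i < N) \sum_(j < N) G (H2 i j.+1).
  move=> G0; apply: eq_bigr => i _; rewrite big_ord_recl/=.
  by rewrite /H2 mul0r !mulr0 G0 add0r.
have term i j : (v.1 * (i.+1%:R * a i.+1 j) + v.2 * (j.+1%:R * a i j.+1))
    * x ^+ i * y ^+ j = v.1 * H1 i.+1 j + v.2 * H2 i j.+1.
  by rewrite /H1 /H2/=; ring.
have -> : dirderiv f v (padd p (x, y)) = v.1 * l1 + v.2 * l2.
  pose V : R := `|v.1| + `|v.2| + 1.
  have V0 : 0 < V by rewrite ltr_wpDl// addr_ge0.
  (* Both coordinates of [t v] are at most [|t| * V], which is at most [s] exactly when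
     [|t| <= s / V]; the constant is [monomial_remainder_le] with [e = |t| * V], summed against the
     bound [M]. *)
  apply: (derive_quadratic_remainder _ _ _ _ (4 * (V / s) ^+ 2 * M) (s / V)).
    exact: divr_gt0.
  move=> t; rewrite ler_pdivlMr// => tV.
  have t1 : `|t * v.1| <= `|t| * V.
    by rewrite normrM ler_wpM2l// /V -addrA lerDl addr_ge0.
  have t2 : `|t * v.2| <= `|t| * V.
    by rewrite normrM ler_wpM2l// /V addrAC lerDr addr_ge0.
  have [xt yt] : `|x + t * v.1| < r /\ `|y + t * v.2| < r.
    by split; apply: le_lt_trans (ler_normD _ _) _;
      [apply: le_lt_trans Xr|apply: le_lt_trans Yr]; rewrite lerD2l (le_trans _ tV).
  have [_ /= ft] := fa (x + t * v.1, y + t * v.2) xt yt.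
  have [_ /= f0] := fa (x, y) xr yr.
  have <- : padd p (x + t * v.1, y + t * v.2) = padd (padd p (x, y)) (pscale t v).
    by rewrite /padd /pscale/= !addrA.
  have flim : (fun N : nat => `|
      (\sum_(i < N) \sum_(j < N) a i j * (x + t * v.1) ^+ i * (y + t * v.2) ^+ j)
      - (\sum_(i < N) \sum_(j < N) a i j * x ^+ i * y ^+ j)
      - t * (v.1 * (\sum_(i < N) \sum_(j < N) H1 i j)
             + v.2 * (\sum_(i < N) \sum_(j < N) H2 i j))|) @ \oo -->
      `|f (padd p (x + t * v.1, y + t * v.2)) - f (padd p (x, y))
        - t * (v.1 * l1 + v.2 * l2)|.
    apply: cvg_norm; apply: cvgB; first exact: cvgB.
    apply: cvgM; first exact: cvg_cst.
    by apply: cvgD; apply: cvgM => //; exact: cvg_cst.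
  apply: (cvgr_to_le flim); near=> N.
  have -> : 4 * (V / s) ^+ 2 * M * t ^+ 2 = (4 * (`|t| * V / s) ^+ 2) * M.
    by rewrite -[t ^+ 2]real_normK ?num_real//; ring.
  have e4 : 0 <= 4 * (`|t| * V / s) ^+ 2 by rewrite mulr_ge0// sqr_ge0.
  apply: le_trans (ler_wpM2l e4 (HM N)).
  rewrite !mulr_sumr -!sumrB -!big_split/= !mulr_sumr -!sumrB.
  apply: le_trans (ler_norm_sum _ _ _) _; apply: ler_sum => i _.
  rewrite !mulr_sumr -!sumrB -!big_split/= !mulr_sumr -!sumrB.
  apply: le_trans (ler_norm_sum _ _ _) _; apply: ler_sum => j _.
  have := monomial_remainder_le x y s _ _ _ i j s0 t1 t2 tV.
  move=> /(ler_wpM2l (normr_ge0 (a i j))); rewrite -normrM => le_ij.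
  have -> : 4 * (`|t| * V / s) ^+ 2 * (`|a i j| * (`|x| + s) ^+ i * (`|y| + s) ^+ j)
    = `|a i j| * (4 * (`|t| * V / s) ^+ 2 * ((`|x| + s) ^+ i * (`|y| + s) ^+ j)).
    by ring.
  apply: le_trans le_ij; rewrite le_eqVlt; apply/orP; left; apply/eqP.
  by congr (`|_|); rewrite /H1 /H2; ring.
split.
  exists (`|v.1| * (s^-1 * M) + `|v.2| * (s^-1 * M)) => N.
  have H1N : \sum_(i < N) \sum_(j < N) `|H1 i.+1 j| <= s^-1 * M.
    rewrite -(H1_shift Num.norm _ (normr0 _)); apply: le_trans (H1M N.+1).
    by apply: ler_sum => i _; rewrite big_ord_recr lerDl.
  have H2N : \sum_(i < N) \sum_(j < N) `|H2 i j.+1| <= s^-1 * M.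
    rewrite -(H2_shift Num.norm _ (normr0 _)); apply: le_trans (H2M N.+1).
    by rewrite [leRHS]big_ord_recr lerDl sumr_ge0.
  apply: le_trans (lerD (ler_wpM2l (normr_ge0 v.1) H1N)
                        (ler_wpM2l (normr_ge0 v.2) H2N)).
  rewrite !mulr_sumr -big_split/=; apply: ler_sum => i _.
  rewrite !mulr_sumr -big_split/=; apply: ler_sum => j _.
  by rewrite -!normrX -!normrM term ler_normD.
rewrite [X in X @ _](_ : _ = (fun N : nat =>
    v.1 * (\sum_(i < N.+1) \sum_(j < N) H1 i j) +
    v.2 * (\sum_(i < N) \sum_(j < N.+1) H2 i j))).
  by apply: cvgD; apply: cvgM => //; exact: cvg_cst.
apply/funext => N; rewrite (H1_shift id)// (H2_shift id)//.
rewrite !mulr_sumr -big_split/=; apply: eq_bigr => i _.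
by rewrite !mulr_sumr -big_split/=; apply: eq_bigr => j _; rewrite term.
Unshelve. all: by end_near. Qed.

Lemma square_sum_antidiagonal (F : nat -> nat -> R) (n N : nat) : (n < N)%N ->
  \sum_(i < N) \sum_(j < N) (if (i + j == n)%N then F i j else 0)
    = \sum_(i < n.+1) F i (n - i)%N.
Proof.
move=> nN; rewrite (big_ord_widen N (fun i => F i (n - i)%N) nN) [RHS]big_mkcond/=.
apply: eq_bigr => i _; rewrite -big_mkcond/= ltnS.
case: leqP => [le_in|lt_ni]; last first.
  by apply: big_pred0 => j; apply/negbTE; rewrite neq_ltn (ltn_addr _ lt_ni) orbT.
have ltN : (n - i < N)%N by apply: leq_ltn_trans nN; exact: leq_subr.
rewrite (big_pred1 (Ordinal ltN))// => j /=.
by rewrite -(inj_eq val_inj)/= -[RHS](eqn_add2l i) subnKC.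
Qed.

(* Along the ray [t |-> p + t v] the series is [t ^+ n] times its degree-[n] part, plus [O(t ^+ n.+1)]. *)
Lemma analytic_at_leading_part_eq0 f p r a n v (d : R) :
  analytic_at f p r a -> 0 < r ->
  (forall i j, (i + j < n)%N -> a i j = 0) -> 0 < d ->
  (forall t, 0 <= t <= d -> f (padd p (pscale t v)) = 0) ->
  \sum_(i < n.+1) a i (n - i)%N * v.1 ^+ i * v.2 ^+ (n - i) = 0.
Proof.
move=> fa r0 an d0 f0.
pose V : R := `|v.1| + `|v.2| + 1.
have V0 : 0 < V by rewrite ltr_wpDl// addr_ge0.
pose e := Num.min d (r / V / 2).
have e0 : 0 < e by rewrite lt_min d0 !divr_gt0.
have ed : e <= d by rewrite ge_min lexx.
have eV : e * V < r.
  rewrite -ltr_pdivlMr//; apply: (@le_lt_trans _ _ (r / V / 2)).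
    by rewrite ge_min lexx orbT.
  by rewrite ltr_pdivrMr// ltr_pMr ?divr_gt0// ltr1n.
have small t : 0 <= t <= e -> `|t * v.1| < r /\ `|t * v.2| < r.
  move=> /andP[t0 te]; rewrite !normrM ger0_norm//.
  by split; apply: le_lt_trans eV; rewrite ler_pM// /V;
    move: (normr_ge0 v.1) (normr_ge0 v.2); lra.
have [|e1 e2] := small e; first by rewrite lexx ltW.
have [[M HM] _] := fa (e * v.1, e * v.2) e1 e2; rewrite /= in HM.
set P := \sum_(i < n.+1) _.
have M0 : 0 <= M by have := HM 0%N; rewrite big_ord0.
(* Subtract the series at [t v], whose sum is 0: degree [n] cancels, lower degrees vanish, and a
   term of higher degree [k] is [(t / e) ^+ k] times its value at [e v], with [t / e <= 1]. *)
have bound t : 0 <= t <= e -> `|t ^+ n * P| <= (t / e) ^+ n.+1 * M.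
  move=> /andP[t0 te].
  have w0 : 0 <= t / e by rewrite divr_ge0// ltW.
  have w1 : t / e <= 1 by rewrite ler_pdivrMr// mul1r.
  have tte : t = t / e * e by rewrite divfK ?gt_eqF.
  have [|t1 t2] := small t; first by rewrite t0.
  have [_ /=] := fa (t * v.1, t * v.2) t1 t2.
  rewrite -[(t * v.1, _)]/(pscale t v) f0; last by rewrite t0 (le_trans te).
  move=> S0; have flim : (fun N : nat => `|t ^+ n * P -
     \sum_(i < N) \sum_(j < N) a i j * (t * v.1) ^+ i * (t * v.2) ^+ j|) @ \oo
     --> `|t ^+ n * P - 0|.
    by apply: cvg_norm; apply: cvgB => //; exact: cvg_cst.
  rewrite -[X in `|X|]subr0; apply: (cvgr_to_le flim); near=> N.
  have nN : (n < N)%N by near: N; exact: nbhs_infty_gt.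
  have -> : t ^+ n * P = \sum_(i < N) \sum_(j < N) (if (i + j == n)%N then
      a i j * (t * v.1) ^+ i * (t * v.2) ^+ j else 0).
    rewrite (square_sum_antidiagonal
      (fun i j => a i j * (t * v.1) ^+ i * (t * v.2) ^+ j))//.
    rewrite mulr_sumr; apply: eq_bigr => i _; rewrite !exprMn.
    by rewrite -[in t ^+ n](subnKC (ltn_ord i : (i <= n)%N)) exprD; ring.
  apply: le_trans (ler_wpM2l _ (HM N)); last exact: exprn_ge0.
  rewrite -sumrB mulr_sumr; apply: le_trans (ler_norm_sum _ _ _) _.
  apply: ler_sum => i _.
  rewrite -sumrB mulr_sumr; apply: le_trans (ler_norm_sum _ _ _) _.
  apply: ler_sum => j _.
  have [ij|ij|ij] := ltngtP (i + j)%N n; last by rewrite subrr normr0 mulr_ge0 ?mulr_ge0 ?exprn_ge0.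
    by rewrite an// normr0 !mul0r subrr normr0 mulr0.
  move: (t / e) w0 w1 tte => w w0 w1 tte.
  rewrite sub0r normrN {1 2}tte !normrM !normrX !normrM (ger0_norm w0).
  have -> : `|a i j| * (w * `|e| * `|v.1|) ^+ i * (w * `|e| * `|v.2|) ^+ j
    = w ^+ (i + j) * (`|a i j| * (`|e| * `|v.1|) ^+ i * (`|e| * `|v.2|) ^+ j).
    by rewrite exprD !exprMn; ring.
  rewrite ler_wpM2r ?mulr_ge0 ?exprn_ge0 ?mulr_ge0//.
  by rewrite ler_wiXn2l.
apply/eqP; rewrite -normr_eq0 eq_le normr_ge0 andbT; apply/ler_addgt0Pr => c c0; rewrite add0r.
(* Dividing [bound] by [t ^+ n] leaves [t * M / e ^+ n.+1], which this [t] makes at most [c]. *)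
pose t := Num.min e (c * e ^+ n.+1 / (M + 1)).
have t0 : 0 < t by rewrite lt_min e0 divr_gt0 ?mulr_gt0 ?exprn_gt0// ltr_wpDl.
have te : t <= e by rewrite ge_min lexx.
have tM : t * (M + 1) <= c * e ^+ n.+1.
  by rewrite -ler_pdivlMr ?ltr_wpDl// ge_min lexx orbT.
have := bound t; rewrite (ltW t0) te => /(_ isT).
rewrite normrM normrX gtr0_norm// exprMn exprVn exprS -!mulrA mulrCA.
rewrite ler_pM2l ?exprn_gt0// => /le_trans; apply.
rewrite mulrCA ler_pdivrMl ?exprn_gt0// [leRHS]mulrC (le_trans _ tM)//.
by rewrite ler_wpM2l ?(ltW t0)// lerDl.
Unshelve. all: by end_near. Qed.

Lemma analytic_at_coef0_val f p r a : 0 < r -> (forall i j, a i j = 0) ->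
  analytic_at f p r a -> f p = 0.
Proof.
move=> r0 a0 fa; have [] := fa (0, 0); rewrite /= ?normr0// => _.
rewrite /padd !addr0 -surjective_pairing => fp.
rewrite [X in X @ _ --> _](_ : _ = cst 0) in fp.
  by apply: (cvg_unique _ fp) => //; exact: cvg_cst.
by apply/funext => N; rewrite big1// => i _; rewrite big1// => j _; rewrite a0 !mul0r.
Qed.

(** Functions with a zero expansion at [p] are stable under [dirderiv], so all iterated partial
    derivatives are among them and vanish at [p]. *)
Lemma analytic_at_coef0_vani f p r a : 0 < r -> (forall i j, a i j = 0) ->
  analytic_at f p r a -> vani_infinite f p.
Proof.
move=> r0 a0 fa.
pose Z g := exists2 b : nat -> nat -> R, (forall i j, b i j = 0) & analytic_at g p r b.
have Zd g v : Z g -> Z (dirderiv g v).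
  move=> [b b0 gb]; have gb' := analytic_at_dirderiv _ _ _ _ v gb.
  by eexists; last exact: gb'; move=> i j /=; rewrite !b0 !mulr0 addr0.
move=> i j; suff [b b0 fb] : Z (pderiv i j f) by exact: analytic_at_coef0_val fb.
rewrite /pderiv; elim: i => [|i IH] /=; last exact: Zd.
by elim: j => [|j IH] /=; [exists a|exact: Zd].
Qed.

End AnalyticAt.

(** * Short rays, polynomial identities and zeros of the cosine *)

Lemma open_ray {R : realType} (Omega : set (pt R)) (p v : pt R) :
  open Omega -> Omega p ->
  exists2 d : R, 0 < d & forall t, 0 <= t <= d -> Omega (padd p (pscale t v)).
Proof.
move=> oO Op; have /nbhs_ballP[/= e e0 eO] := open_nbhs_nbhs (conj oO Op).
pose V : R := `|v.1| + `|v.2| + 1.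
have V0 : 0 < V by rewrite ltr_wpDl// addr_ge0.
exists (e / 2 / V) => [|t /andP[t0]]; first by rewrite !divr_gt0.
rewrite ler_pdivlMr// => tV; apply: eO.
have small (z : R) : `|z| <= V -> `|t * z| < e.
  move=> zV; rewrite normrM ger0_norm//; apply: (@le_lt_trans _ _ (t * V)).
    by rewrite ler_wpM2l.
  by apply: le_lt_trans tV _; rewrite ltr_pdivrMr// ltr_pMr// ltr1n.
by split; rewrite /ball/= opprD addrA subrr sub0r normrN; apply: small;
  rewrite /V; move: (normr_ge0 v.1) (normr_ge0 v.2); lra.
Qed.

Lemma polynomial_sum_eq0 {R : realType} (c : nat -> R) (n : nat) :
  (forall x, \sum_(i < n) c i * x ^+ i = 0) -> forall i, (i < n)%N -> c i = 0.
Proof.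
move=> c0 i lt_in; pose p := \poly_(i < n) c i.
suff p0 : p = 0 by have := coef_poly n c i; rewrite lt_in -/p p0 coef0.
(* The naturals below [n] are [n] distinct roots of a polynomial of size at most [n]. *)
apply: (@roots_geq_poly_eq0 _ p [seq k%:R | k <- iota 0 n]).
- by apply/allP => _ /mapP[k _ ->]; rewrite /root horner_poly c0.
- by rewrite map_inj_uniq ?iota_uniq//; exact: (mulrIn (oner_neq0 R)).
- by rewrite size_map size_iota size_poly.
Qed.

(** Such a [y] is a half-integer: the fractional part [w] of [y + 1/2] satisfies [sin (w * pi) = 0]
    with [0 <= w < 1], hence [w = 0]. *)
Lemma cos_mulpi_eq0_rational {R : realType} (y : R) :
  0 <= y -> cos (y * pi) = 0 -> rational y.
Proof.
move=> y0; rewrite -sinDpihalf => sy.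
have z0 : 0 <= y + 2^-1 by rewrite addr_ge0// invr_ge0.
have /andP[nz zn] := truncn_itv z0; set n := Num.truncn _ in nz zn.
pose w := y + 2^-1 - n%:R.
have w0 : 0 <= w by rewrite subr_ge0.
have w1 : w < 1 by rewrite ltrBlDl natr1.
have zw : y * pi + pi / 2 = w * pi + pi *+ n by rewrite /w -mulr_natl; ring.
move: sy; rewrite zw (alternatingn (@sinDpi R)) => /eqP.
rewrite mulf_eq0 signr_eq0/= => /eqP sw.
have {}w0 : w = 0.
  apply/eqP; rewrite eq_le w0 andbT leNgt; apply/negP => wp.
  have : 0 < sin (w * pi).
    by rewrite sin_gt0_pi// mulr_gt0 ?pi_gt0//= gtr_pMl ?pi_gt0.
  by rewrite sw ltxx.
exists (n%:R - 2^-1); first by [].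
by rewrite rmorphB/= fmorphV/= !ratr_nat -(subrK 2^-1 y); move: w0; rewrite /w; lra.
Qed.

(** * Homogeneous harmonic polynomials in polar form *)

Section HarmonicPolynomial.
Context {R : realType}.
Implicit Types (w : nat -> R) (a : nat -> nat -> R).

(** Pascal's rule; the weight is arbitrary because the second sum carries the shifted weight, to
    which an induction over all weights applies again. *)
Lemma binomial_sum_recr w (x y : R) (n : nat) :
  \sum_(i < n.+2) 'C(n.+1, i)%:R * w i * x ^+ i * y ^+ (n.+1 - i) =
  y * (\sum_(i < n.+1) 'C(n, i)%:R * w i * x ^+ i * y ^+ (n - i)) +
  x * (\sum_(i < n.+1) 'C(n, i)%:R * w i.+1 * x ^+ i * y ^+ (n - i)).
Proof.
rewrite big_ord_recl/= bin0 mul1r expr0 mulr1 subn0.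
under eq_bigr => i _ do rewrite /bump/= add1n binS natrD subSS.
have -> : \sum_(i < n.+1) ('C(n, i.+1)%:R + 'C(n, i)%:R) * w i.+1 * x ^+ i.+1 * y ^+ (n - i)
  = \sum_(i < n.+1) 'C(n, i.+1)%:R * w i.+1 * x ^+ i.+1 * y ^+ (n - i)
  + x * \sum_(i < n.+1) 'C(n, i)%:R * w i.+1 * x ^+ i * y ^+ (n - i).
  by rewrite mulr_sumr -big_split/=; apply: eq_bigr => i _; rewrite exprS; ring.
rewrite addrA; congr (_ + _).
rewrite big_ord_recr/= bin_small// !mul0r addr0.
rewrite [X in _ = _ * X]big_ord_recl/= bin0 mul1r expr0 mulr1 subn0 mulrDr exprS.
congr (_ + _); first by ring.
rewrite mulr_sumr; apply: eq_bigr => i _; rewrite /bump/= add1n.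
by rewrite -(subnSK (ltn_ord i)) [y ^+ _.+1]exprS; ring.
Qed.

(* With [w 0 = 1, w 1 = 0] (resp. [0, 1]) the left-hand side is the real (resp. imaginary) part of [(cos phi + i sin phi) ^+ n]. *)
Lemma binomial_sum_sin_cos w (phi : R) (n : nat) :
  (forall i, w i.+2 = - w i) ->
  \sum_(i < n.+1) 'C(n, i)%:R * w i * sin phi ^+ i * cos phi ^+ (n - i)
    = w 0%N * cos (n%:R * phi) + w 1%N * sin (n%:R * phi).
Proof.
elim: n w => [|n IH] w w2.
  rewrite big_ord_recl big_ord0 bin0 mul0r cos0 sin0 !expr0 mulr0 addr0.
  by rewrite mul1r !mulr1 addr0.
rewrite binomial_sum_recr IH// (IH (fun i => w i.+1)) => [|i]; last exact: w2.
rewrite w2 -natr1 mulrDl mul1r cosD sinD; ring.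
Qed.

Lemma harmonic_leading_part_eq0 a (n : nat) (phi psi : R) :
  (forall i j, (i + j).+2 = n.+1 ->
    (i.+2 * i.+1)%:R * a i.+2 j + (j.+2 * j.+1)%:R * a i j.+2 = 0) ->
  \sum_(i < n.+2) a i (n.+1 - i)%N * sin psi ^+ i * cos psi ^+ (n.+1 - i) = 0 ->
  \sum_(i < n.+1) (- cos phi * (i.+1%:R * a i.+1 (n - i)%N)
                   + sin phi * ((n - i).+1%:R * a i (n - i).+1))
    * sin phi ^+ i * cos phi ^+ (n - i) = 0 ->
  cos (n.+1%:R * (phi - psi)) != 0 ->
  forall i j, (i + j)%N = n.+1 -> a i j = 0.
Proof.
move=> harm ray normal cos_neq0.
(* [q i] is the derivative of the form, [i] times in the first variable and [n.+1 - i] times in the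
   second. Harmonicity reads [q i.+2 = - q i], so [q] agrees up to [n.+1] with a sequence [w]
   obeying this rule at every index. *)
pose q i := (i`! * (n.+1 - i)`!)%:R * a i (n.+1 - i)%N.
pose w i := (-1) ^+ i./2 * q (odd i).
have w2 i : w i.+2 = - w i by rewrite /w/= negbK exprS mulN1r mulNr.
have qw i : (i <= n.+1)%N -> q i = w i.
  elim/ltn_ind: i => -[|[|i]] IH le_in; rewrite ?w2.
  - by rewrite /w expr0 mul1r.
  - by rewrite /w expr0 mul1r.
  rewrite -IH//; last by rewrite ltnW// ltnW.
  have /= := harm i (n.+1 - i.+2)%N; rewrite -!addSn subnKC// => /(_ erefl).
  rewrite /q; have -> : (n.+1 - i = (n.+1 - i.+2).+2)%N by lia.
  move: (n.+1 - i.+2)%N => j /eqP; rewrite addr_eq0 => /eqP.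
  move=> E; rewrite !factS !natrM in E *.
  transitivity ((i`!)%:R * (j`!)%:R * (i.+2%:R * i.+1%:R * a i.+2 j)); first by ring.
  by rewrite E; ring.
have fact_neq0 k : (k`!)%:R != 0 :> R by rewrite pnatr_eq0 -lt0n fact_gt0.
have aw i j : (i + j)%N = n.+1 -> a i j = w i / ((i`!)%:R * (j`!)%:R).
  move=> ij; have le_in : (i <= n.+1)%N by rewrite -ij leq_addr.
  rewrite -qw// /q -ij addKn natrM; field.
  by rewrite !fact_neq0.
have binE k i : (i <= k)%N -> 'C(k, i)%:R = (k`!)%:R / ((i`!)%:R * ((k - i)`!)%:R) :> R.
  by move=> ik; rewrite -(bin_fact ik) !natrM mulfK// mulf_neq0.
have ray0 : w 0%N * cos (n.+1%:R * psi) + w 1%N * sin (n.+1%:R * psi) = 0.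
  rewrite -binomial_sum_sin_cos// -[RHS](mulr0 (n.+1`!)%:R) -[in RHS]ray mulr_sumr.
  apply: eq_bigr => i _; have le_in : (i <= n.+1)%N by rewrite -ltnS.
  by rewrite binE// aw ?subnKC//; ring.
have normal0 : w 0%N * sin (n.+1%:R * phi) - w 1%N * cos (n.+1%:R * phi) = 0.
  (* The weight of the normal derivative, a form of degree [n] obeying the same sign rule; the
     addition formulas restore the frequency [n.+1]. *)
  pose b i := - cos phi * w i.+1 + sin phi * w i.
  have b2 i : b i.+2 = - b i by rewrite /b !w2; ring.
  transitivity (b 0%N * cos (n%:R * phi) + b 1%N * sin (n%:R * phi)).
    by rewrite /b w2 -natr1 mulrDl mul1r sinD cosD; ring.
  rewrite -binomial_sum_sin_cos// -[RHS](mulr0 (n`!)%:R) -[in RHS]normal mulr_sumr.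
  apply: eq_bigr => i _; have le_in : (i <= n)%N by rewrite -ltnS.
  rewrite binE// !aw ?addSn ?addnS ?subnKC// /b !factS !natrM.
  field.
  by rewrite !fact_neq0 !(addrC 1) !natr1 !pnatr_eq0.
have cosE : cos (n.+1%:R * (phi - psi)) = cos (n.+1%:R * phi) * cos (n.+1%:R * psi)
    + sin (n.+1%:R * phi) * sin (n.+1%:R * psi) by rewrite mulrBr cosB.
(* Cramer's rule: eliminating [w 1] here, and [w 0] below, leaves the determinant [cosE] as
   factor. *)
have w0 : w 0%N = 0.
  apply: (mulIf cos_neq0); rewrite mul0r cosE.
  move: ray0 normal0; set c1 := cos _; set s1 := sin _; set s2 := sin _; set c2 := cos _.
  move=> e1 e2; transitivity (c2 * (w 0%N * c1 + w 1%N * s1) + s1 * (w 0%N * s2 - w 1%N * c2)).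
    by ring.
  by rewrite e1 e2 !mulr0 addr0.
have w1 : w 1%N = 0.
  apply: (mulIf cos_neq0); rewrite mul0r cosE.
  move: ray0 normal0; set c1 := cos _; set s1 := sin _; set s2 := sin _; set c2 := cos _.
  move=> e1 e2; transitivity (s2 * (w 0%N * c1 + w 1%N * s1) - c1 * (w 0%N * s2 - w 1%N * c2)).
    by ring.
  by rewrite e1 e2 !mulr0 subr0.
move=> i j ij; rewrite aw//; suff -> : w i = 0 by rewrite mul0r.
move: w0 w1; rewrite /w/= expr0 !mul1r => q0 q1.
by case: (odd i); rewrite ?q0 ?q1 mulr0.
Qed.

End HarmonicPolynomial.

(** * Unit directions, the Helmholtz equation and the conclusion *)

(** The angle runs clockwise from the second axis, matching the powers of [sin] and [cos] in
    [binomial_sum_sin_cos]; hence [rot2 theta] subtracts [theta] from it. *)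
Lemma unit_vec_sin_cos {R : realType} (e : pt R) : unit_vec e ->
  exists phi : R, e = (sin phi, cos phi).
Proof.
case: e => x y; rewrite /unit_vec/= => xy1.
have y1 : -1 <= y <= 1 by move: (sqr_ge0 x); nra.
have yE : cos (acos y) = y by exact: acosK.
have : x ^+ 2 = sin (acos y) ^+ 2 by rewrite sin2cos2 yE -xy1 addrK.
move/eqP; rewrite eqf_sqr => /orP[|] /eqP ->.
  by exists (acos y); rewrite yE.
by exists (- acos y); rewrite sinN cosN yE.
Qed.

(* The degree-[n] part of [Delta u + lambda u] only involves the degree-[n.+2] part of [u] once the lower ones vanish. *)
Lemma helmholtz_coefs_harmonic {R : realType} (Omega : set (pt R)) (lambda : R)
    (u : pt R -> R) (x0 : pt R) (r : R) (a : nat -> nat -> R) (n : nat) :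
  open Omega -> Omega x0 ->
  (forall p, Omega p -> - laplacian u p = lambda * u p) ->
  0 < r -> analytic_at u x0 r a ->
  (forall i j, (i + j < n)%N -> a i j = 0) ->
  forall i j, (i + j).+2 = n ->
    (i.+2 * i.+1)%:R * a i.+2 j + (j.+2 * j.+1)%:R * a i j.+2 = 0.
Proof.
move=> oO Ox0 eqn r0 ua an i j ijn.
have uxx := analytic_at_dirderiv _ _ _ _ (ex R) (analytic_at_dirderiv _ _ _ _ (ex R) ua).
have uyy := analytic_at_dirderiv _ _ _ _ (ey R) (analytic_at_dirderiv _ _ _ _ (ey R) ua).
have := analytic_at_add_scale _ _ _ _ _ _ lambda
  (analytic_at_add_scale _ _ _ _ _ _ 1 uxx uyy) ua.
set c := (fun i j : nat => _ : R); set g := (fun q : pt R => _ : R) => gc.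
have cE k l : c k l = (k.+2 * k.+1)%:R * a k.+2 l + (l.+2 * l.+1)%:R * a k l.+2
    + lambda * a k l.
  by rewrite /c/= !natrM; ring.
have g0 q : Omega q -> g q = 0.
  move=> /eqn; rewrite /g mul1r => <-.
  by rewrite /laplacian /dx /dy /dirderiv subrr.
have c0 k l : (k + l < i + j)%N -> c k l = 0.
  by move=> kl; rewrite cE !an ?mulr0 ?addr0//; lia.
(* In the direction [(x, 1)] the leading part is a polynomial in [x] alone; it vanishes for every
   [x], so its coefficients do. *)
have lead x : \sum_(k < (i + j).+1) c k (i + j - k)%N * x ^+ k = 0.
  have [d d0 dO] := open_ray Omega x0 (x, 1) oO Ox0.
  have := analytic_at_leading_part_eq0 _ _ _ _ _ (x, 1) d gc r0 c0 d0.
  move=> /(_ (fun t td => g0 _ (dO t td))) /= lead0.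
  by rewrite -[RHS]lead0; apply: eq_bigr => k _; rewrite expr1n mulr1.
have := polynomial_sum_eq0 (fun k => c k (i + j - k)%N) _ lead i.
rewrite ltnS leq_addr addKn cE => /(_ isT).
by rewrite (an i j) ?mulr0 ?addr0//; lia.
Qed.

Theorem theorem4p4 (R : realType) (Omega : set (pt R)) (lambda : R)
  (u : pt R -> R) (x0 : pt R) (h alpha : R) (em ep : pt R) :
  open Omega ->
  0 < lambda ->
  in_L2 Omega u ->
  real_analytic_on Omega u ->
  (forall p, Omega p -> - laplacian u p = lambda * u p) ->
  Omega x0 -> 0 < h ->
  unit_vec em -> 0 < alpha -> alpha < 2%:R -> irrational alpha ->
  ep = rot2 (alpha * @pi R) em ->
  segment x0 em h `<=` Omega ->
  segment x0 ep h `<=` Omega ->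
  (forall p, segment x0 em h p -> dirderiv u (- em.2, em.1) p = 0) ->
  (forall p, segment x0 ep h p -> u p = 0) ->
  vani_infinite u x0.
Proof.
move=> oO _ _ anu eqn Ox0 h0 /unit_vec_sin_cos[phi ->] alpha0 _ irr -> _ _ sing nod.
set theta := alpha * pi.
have epE : rot2 theta (sin phi, cos phi) = (sin (phi - theta), cos (phi - theta)).
  by rewrite /rot2/= sinB cosB; congr (_, _); ring.
rewrite epE in nod.
have [r [r0 [a ua]]] := anu x0 Ox0.
have {}ua : analytic_at u x0 r a by [].
have nod0 t : 0 <= t <= h ->
    u (padd x0 (pscale t (sin (phi - theta), cos (phi - theta)))) = 0.
  by move=> th; apply: nod; exists t.
have sing0 t : 0 <= t <= h ->
    dirderiv u (- cos phi, sin phi) (padd x0 (pscale t (sin phi, cos phi))) = 0.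
  by move=> th; apply: sing; exists t.
(* The choice of a lowest nonzero degree becomes an induction: if all degrees below [n] vanish, so
   does degree [n]. *)
suff a0 n i j : (i + j < n)%N -> a i j = 0.
  by apply: (analytic_at_coef0_vani _ _ _ _ r0 _ ua) => i j; exact: (a0 (i + j).+1).
elim: n i j => [//|n IH] i j; rewrite ltnS leq_eqVlt => /orP[/eqP ijn|]; last exact: IH.
have ray := analytic_at_leading_part_eq0 _ _ _ _ _ _ _ ua r0 IH h0 nod0.
(* In degree 0 the leading part is a constant, killed by the nodal condition alone. *)
case: n IH ray ijn => [|n] IH ray ijn.
  move: ray; rewrite big_ord_recl big_ord0 /= !expr0 !mulr1 addr0.
  by move: ijn; case: i => //; case: j.
apply: (harmonic_leading_part_eq0 _ n phi (phi - theta) _ ray) ijn.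
- exact: helmholtz_coefs_harmonic oO Ox0 eqn r0 ua IH.
- apply: (analytic_at_leading_part_eq0 _ _ _ _ _ (sin phi, cos phi) _
    (analytic_at_dirderiv _ _ _ _ (- cos phi, sin phi) ua) r0 _ h0 sing0).
  by move=> k l kl /=; rewrite !IH ?mulr0 ?addr0//; lia.
(* The angle difference is [theta]; a zero determinant would make [n.+1%:R * alpha], hence [alpha],
   rational. *)
apply/eqP; rewrite opprB addrC subrK /theta mulrA => cos0.
have [|q _ qE] := cos_mulpi_eq0_rational (n.+1%:R * alpha) _ cos0.
  by rewrite mulr_ge0// ltW.
apply: irr; exists (q / n.+1%:R) => //.
by rewrite fmorph_div/= qE ratr_nat mulrC mulKf// pnatr_eq0.
Qed.
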